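(* Let $\mathtt T$ be a tricategory. The following data define a tricategory $\widehat{\mathtt T}$ and a virtually strict triequivalence $\operatorname{ev}:\widehat{\mathtt T}\to\mathtt T$. (1) The objects of $\widehat{\mathtt T}$ are those of $\mathtt T$, and $\operatorname{ev}$ is the identity on objects. (2) 1-morphisms of $\widehat{\mathtt T}$ are defined inductively: every 1-morphism of $\mathtt T$ is a 1-morphism of $\widehat{\mathtt T}$ with the same source and target (a basic 1-morphism); for 1-morphisms $\hat f:b\to c$, $\hat g:a\to b$ of $\widehat{\mathtt T}$ the formal composite $\hat f\mathbin{\hat\otimes}\hat g:a\to c$ is a 1-morphism of $\widehat{\mathtt T}$. Composition of 1-morphisms is $\hat\otimes$. On basic 1-morphisms $\operatorname{ev}$ is the identity and $\operatorname{ev}(\hat f\mathbin{\hat\otimes}\hat g)=\operatorname{ev}(\hat f)\otimes\operatorname{ev}(\hat g)$. (3) 2-morphisms of $\widehat{\mathtt T}$ are defined inductively: basic ones are triples $(\alpha,\hat f,\hat g):\hat f\to\hat g$ with $\hat f,\hat g$ 1-morphisms of $\widehat{\mathtt T}$ and $\alpha:\operatorname{ev}(\hat f)\to\operatorname{ev}(\hat g)$ a 2-morphism of $\mathtt T$; for 2-morphisms $\hat\beta:\hat g_1\to\hat g_2:b\to c$, $\hat\alpha_1:\hat f_1\to\hat f_2:a\to b$, $\hat\alpha_2:\hat f_2\to\hat f_3:a\to b$ the formal composites $\hat\beta\mathbin{\hat\otimes}\hat\alpha_1:\hat g_1\mathbin{\hat\otimes}\hat f_1\to\hat g_2\mathbin{\hat\otimes}\hat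 f_2$ and $\hat\alpha_2\mathbin{\hat *}\hat\alpha_1:\hat f_1\to\hat f_3$ are 2-morphisms. Composition of 2-morphisms along objects, resp. 1-morphisms, is $\hat\otimes$, resp. $\hat *$. Moreover $\operatorname{ev}(\alpha,\hat f,\hat g)=\alpha$, $\operatorname{ev}(\hat\alpha\mathbin{\hat\otimes}\hat\beta)=\operatorname{ev}(\hat\alpha)\otimes\operatorname{ev}(\hat\beta)$, $\operatorname{ev}(\hat\alpha\mathbin{\hat *}\hat\beta)=\operatorname{ev}(\hat\alpha)*\operatorname{ev}(\hat\beta)$. (4) 3-morphisms of $\widehat{\mathtt T}$ are triples $(\Pi,\hat\alpha,\hat\beta):\hat\alpha\to\hat\beta$ with $\Pi:\operatorname{ev}(\hat\alpha)\to\operatorname{ev}(\hat\beta)$ a 3-morphism of $\mathtt T$ (where $\hat\alpha,\hat\beta$ are parallel). Composition is $(\Pi,\hat\alpha_1,\hat\alpha_2)\mathbin{\hat\otimes}(\Lambda,\hat\beta_1,\hat\beta_2)=(\Pi\otimes\Lambda,\hat\alpha_1\mathbin{\hat\otimes}\hat\beta_1,\hat\alpha_2\mathbin{\hat\otimes}\hat\beta_2)$, $(\Pi,\hat\alpha_1,\hat\alpha_2)\mathbin{\hat *}(\Lambda,\hat\beta_1,\hat\beta_2)=(\Pi*\Lambda,\hat\alpha_1\mathbin{\hat *}\hat\beta_1,\hat\alpha_2\mathbin{\hat *}\hat\beta_2)$, $(\Pi,\hat\alpha_2,\hat\alpha_3)\circ(\Lambda,\hat\alpha_1,\hat\alpha_2)=(\Pi\circ\Lambda,\hat\alpha_1,\hat\alpha_3)$,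 and $\operatorname{ev}(\Pi,\hat\alpha,\hat\beta)=\Pi$. (5) The units are $\hat 1_a=1_a$, $\hat 1_{\hat f}=(1_{\operatorname{ev}(\hat f)},\hat f,\hat f)$, $\hat 1_{\hat\alpha}=(1_{\operatorname{ev}(\hat\alpha)},\hat\alpha,\hat\alpha)$. Each constraint cell of $\widehat{\mathtt T}$ is the corresponding constraint cell of $\mathtt T$ at the evaluated indices, equipped with the corresponding formal source and target; for example $\hat a_{\hat f\hat g\hat h}=\big(a_{\operatorname{ev}(\hat f)\operatorname{ev}(\hat g)\operatorname{ev}(\hat h)},(\hat f\mathbin{\hat\otimes}\hat g)\mathbin{\hat\otimes}\hat h,\hat f\mathbin{\hat\otimes}(\hat g\mathbin{\hat\otimes}\hat h)\big)$ and $\hat a_{\hat\alpha\hat\beta\hat\gamma}=\big(a_{\operatorname{ev}(\hat\alpha)\operatorname{ev}(\hat\beta)\operatorname{ev}(\hat\gamma)},\ \hat a_{t\hat\alpha,t\hat\beta,t\hat\gamma}\mathbin{\hat *}((\hat\alpha\mathbin{\hat\otimes}\hat\beta)\mathbin{\hat\otimes}\hat\gamma),\ (\hat\alpha\mathbin{\hat\otimes}(\hat\beta\mathbin{\hat\otimes}\hat\gamma))\mathbin{\hat *}\hat a_{s\hat\alpha,s\hat\beta,s\hat\gamma}\big)$, and analogously for all other constraint cells.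
   Context: Tricategories are in the fully algebraic sense of Gurski: objects, local bicategories $\mathtt T(a,b)$, weak functors $\otimes$ (composition) and $I_a:\mathtt 1\to\mathtt T(a,a)$ (units), adjoint equivalences $a\dashv a^{\blacksquare}$, $l\dashv l^{\blacksquare}$, $r\dashv r^{\blacksquare}$ (with units $\eta^a,\eta^l,\eta^r$ and counits $\epsilon^a,\epsilon^l,\epsilon^r$) in functor bicategories, and invertible modifications $\pi,\mu,\lambda,\rho$, subject to the usual three axioms. Composition along objects, 1-morphisms, 2-morphisms is written $\otimes,*,\circ$; $s,t$ denote source and target; two $n$-morphisms are parallel if they have the same source and target. Write $1_a=I_a(\bullet)$, $i_a=I_a(1_\bullet):1_a\to 1_a$, $\phi_a:1_{1_a}\to i_a$. The constraint cells are $i_a$, $\phi_a$, components of the local constraints $a^{loc},l^{loc},r^{loc}$ of the local bicategories, the interchangers $\phi^\otimes_{(\alpha,\beta)(\alpha',\beta')}:(\alpha\otimes\beta)*(\alpha'\otimes\beta')\to(\alpha*\alpha')\otimes(\beta*\beta')$, the cells $\phi^\otimes_{(f,g)}:1_{f\otimes g}\to 1_f\otimes 1_g$, and all components (at 1-morphisms and at 2-morphisms, where applicable) of $a,a^\blacksquare,l,l^\blacksquare,r,r^\blacksquare,\eta^a,\epsilon^a,\eta^l,\epsilon^l,\eta^r,\epsilon^r,\pi,\mu,\lambda,\rho$. Virtually strict functor $F:\mathtt T\to\mathtt T'$: assignments on objects, 1-, 2-, 3-morphisms preserving sources and targets, strictly preserving $\otimes,*,\circ$, all units and all constraint cells. It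 is a virtually strict triequivalence if every object $a'$ of $\mathtt T'$ admits an object $a$ of $\mathtt T$ and a biequivalence $Fa\to a'$ in $\mathtt T'$, and each $\mathtt T(a,b)\to\mathtt T'(Fa,Fb)$ is a strict functor of bicategories which is a biequivalence (surjective on objects up to equivalence, essentially surjective on local categories, bijective on sets of 2-cells). *)

(* Defs.v *)
(* Throughout, the data of a structure (bicategory, weak functor, ...,
   tricategory) and its axioms are kept in separate records, so that one can
   first write down data and then assert that they form such a structure.
   Primitive projections make the composites of data below (e.g. the two
   bracketings of a threefold composite of functors) convertible on objects
   and 1-cells. *)

Set Implicit Arguments.
Unset Strict Implicit.
Unset Printing Implicit Defensive.
Set Primitive Projections.

Declare Scope cell_scope.
Delimit Scope cell_scope with cell.
Local Open Scope cell_scope.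

Record cell_pair (A B : Type) := Pair { p1 : A; p2 : B }.
Notation "⟨ x , y ⟩" := (Pair x y) (at level 0, x at level 99, y at level 99)
  : cell_scope.

(* [comp v u] is the composite of [u : x -> y] followed by [v : y -> z].
   [assocV], [lunV], [runV] are the inverses of the constraint cells. *)
Record bicat_data := BicatData {
  obj :> Type;
  hom1 : obj -> obj -> Type;
  hom2 : forall x y, hom1 x y -> hom1 x y -> Type;
  id1 : forall x, hom1 x x;
  comp : forall x y z, hom1 y z -> hom1 x y -> hom1 x z;
  id2 : forall x y (u : hom1 x y), hom2 u u;
  vcomp : forall x y (u v w : hom1 x y), hom2 v w -> hom2 u v -> hom2 u w;
  hcomp : forall x y z (v v' : hom1 y z) (u u' : hom1 x y),
    hom2 v v' -> hom2 u u' -> hom2 (comp v u) (comp v' u');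
  assoc : forall w x y z (h : hom1 y z) (g : hom1 x y) (f : hom1 w x),
    hom2 (comp (comp h g) f) (comp h (comp g f));
  assocV : forall w x y z (h : hom1 y z) (g : hom1 x y) (f : hom1 w x),
    hom2 (comp h (comp g f)) (comp (comp h g) f);
  lun : forall x y (u : hom1 x y), hom2 (comp (id1 y) u) u;
  lunV : forall x y (u : hom1 x y), hom2 u (comp (id1 y) u);
  run : forall x y (u : hom1 x y), hom2 (comp u (id1 x)) u;
  runV : forall x y (u : hom1 x y), hom2 u (comp u (id1 x))
}.

Arguments hom1 {b} x y.
Arguments hom2 {b x y} u v.
Arguments id1 {b} x.
Arguments comp {b x y z} v u.
Arguments id2 {b x y} u.
Arguments vcomp {b x y u v w} _ _.
Arguments hcomp {b x y z v v' u u'} _ _.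
Arguments assoc {b w x y z} h g f.
Arguments assocV {b w x y z} h g f.
Arguments lun {b x y} u.
Arguments lunV {b x y} u.
Arguments run {b x y} u.
Arguments runV {b x y} u.

Notation "v * u" := (comp v u) (at level 40, left associativity) : cell_scope.
Notation "t ⋆ s" := (hcomp t s) (at level 40, left associativity) : cell_scope.
Notation "t ∘ s" := (vcomp t s) (at level 45, right associativity) : cell_scope.

Definition inverse2 (B : bicat_data) (x y : B) (u v : hom1 x y)
    (s : hom2 u v) (t : hom2 v u) : Prop :=
  t ∘ s = id2 u /\ s ∘ t = id2 v.

Definition invertible2 (B : bicat_data) (x y : B) (u v : hom1 x y)
    (s : hom2 u v) : Prop :=
  exists t : hom2 v u, inverse2 s t.

Definition isomorphic1 (B : bicat_data) (x y : B) (u v : hom1 x y) : Prop :=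
  exists s : hom2 u v, invertible2 s.

Definition equivalent0 (B : bicat_data) (x y : B) : Prop :=
  exists (u : hom1 x y) (v : hom1 y x),
    isomorphic1 (v * u) (id1 x) /\ isomorphic1 (u * v) (id1 y).

Unset Primitive Projections.
Record is_bicat (B : bicat_data) : Prop := IsBicat {
  vcomp_id2l : forall (x y : B) (u v : hom1 x y) (s : hom2 u v), id2 v ∘ s = s;
  vcomp_id2r : forall (x y : B) (u v : hom1 x y) (s : hom2 u v), s ∘ id2 u = s;
  vcomp_assoc : forall (x y : B) (u v w w' : hom1 x y)
    (r : hom2 w w') (s : hom2 v w) (t : hom2 u v), (r ∘ s) ∘ t = r ∘ (s ∘ t);
  hcomp_id2 : forall (x y z : B) (v : hom1 y z) (u : hom1 x y),
    id2 v ⋆ id2 u = id2 (v * u);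
  hcomp_vcomp : forall (x y z : B) (v v' v'' : hom1 y z) (u u' u'' : hom1 x y)
    (t' : hom2 v' v'') (t : hom2 v v') (s' : hom2 u' u'') (s : hom2 u u'),
    (t' ∘ t) ⋆ (s' ∘ s) = (t' ⋆ s') ∘ (t ⋆ s);
  assoc_nat : forall (w x y z : B) (h h' : hom1 y z) (g g' : hom1 x y)
    (f f' : hom1 w x) (r : hom2 h h') (s : hom2 g g') (t : hom2 f f'),
    assoc h' g' f' ∘ ((r ⋆ s) ⋆ t) = (r ⋆ (s ⋆ t)) ∘ assoc h g f;
  lun_nat : forall (x y : B) (u v : hom1 x y) (s : hom2 u v),
    lun v ∘ (id2 (id1 y) ⋆ s) = s ∘ lun u;
  run_nat : forall (x y : B) (u v : hom1 x y) (s : hom2 u v),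
    run v ∘ (s ⋆ id2 (id1 x)) = s ∘ run u;
  assoc_inv : forall (w x y z : B) (h : hom1 y z) (g : hom1 x y) (f : hom1 w x),
    inverse2 (assoc h g f) (assocV h g f);
  lun_inv : forall (x y : B) (u : hom1 x y), inverse2 (lun u) (lunV u);
  run_inv : forall (x y : B) (u : hom1 x y), inverse2 (run u) (runV u);
  pentagon : forall (v w x y z : B) (k : hom1 y z) (h : hom1 x y)
    (g : hom1 w x) (f : hom1 v w),
    assoc k h (g * f) ∘ assoc (k * h) g f
    = (id2 k ⋆ assoc h g f) ∘ (assoc k (h * g) f ∘ (assoc k h g ⋆ id2 f));
  triangle : forall (x y z : B) (v : hom1 y z) (u : hom1 x y),
    (id2 v ⋆ lun u) ∘ assoc v (id1 y) u = run v ⋆ id2 u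
}.
Set Primitive Projections.

Definition one_bicat : bicat_data := {|
  obj := unit;
  hom1 := fun _ _ => unit;
  hom2 := fun _ _ _ _ => unit;
  id1 := fun _ => tt;
  comp := fun _ _ _ _ _ => tt;
  id2 := fun _ _ _ => tt;
  vcomp := fun _ _ _ _ _ _ _ => tt;
  hcomp := fun _ _ _ _ _ _ _ _ _ => tt;
  assoc := fun _ _ _ _ _ _ _ => tt;
  assocV := fun _ _ _ _ _ _ _ => tt;
  lun := fun _ _ _ => tt;
  lunV := fun _ _ _ => tt;
  run := fun _ _ _ => tt;
  runV := fun _ _ _ => tt
|}.

Definition prod_bicat (B C : bicat_data) : bicat_data := {|
  obj := cell_pair B C;
  hom1 := fun x y => cell_pair (hom1 (p1 x) (p1 y)) (hom1 (p2 x) (p2 y));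
  hom2 := fun _ _ u v => cell_pair (hom2 (p1 u) (p1 v)) (hom2 (p2 u) (p2 v));
  id1 := fun x => ⟨id1 (p1 x), id1 (p2 x)⟩;
  comp := fun _ _ _ v u => ⟨p1 v * p1 u, p2 v * p2 u⟩;
  id2 := fun _ _ u => ⟨id2 (p1 u), id2 (p2 u)⟩;
  vcomp := fun _ _ _ _ _ t s => ⟨p1 t ∘ p1 s, p2 t ∘ p2 s⟩;
  hcomp := fun _ _ _ _ _ _ _ t s => ⟨p1 t ⋆ p1 s, p2 t ⋆ p2 s⟩;
  assoc := fun _ _ _ _ h g f =>
    ⟨assoc (p1 h) (p1 g) (p1 f), assoc (p2 h) (p2 g) (p2 f)⟩;
  assocV := fun _ _ _ _ h g f =>
    ⟨assocV (p1 h) (p1 g) (p1 f), assocV (p2 h) (p2 g) (p2 f)⟩;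
  lun := fun _ _ u => ⟨lun (p1 u), lun (p2 u)⟩;
  lunV := fun _ _ u => ⟨lunV (p1 u), lunV (p2 u)⟩;
  run := fun _ _ u => ⟨run (p1 u), run (p2 u)⟩;
  runV := fun _ _ u => ⟨runV (p1 u), runV (p2 u)⟩
|}.
Notation "B × C" := (prod_bicat B C) (at level 40, left associativity)
  : cell_scope.

Record map1 (B C : bicat_data) := Map1 {
  m0 :> B -> C;
  m1 : forall x y : B, hom1 x y -> hom1 (m0 x) (m0 y)
}.
Arguments m0 {B C} m x.
Arguments m1 {B C} m {x y} u.

Record map2 (B C : bicat_data) := Map2 {
  m_map1 :> map1 B C;
  m2 : forall (x y : B) (u v : hom1 x y),
    hom2 u v -> hom2 (m1 m_map1 u) (m1 m_map1 v)
}.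
Arguments m_map1 {B C} m.
Arguments m2 {B C} m {x y u v} s.

Record functor_data (B C : bicat_data) := FunctorData {
  f_map2 :> map2 B C;
  phi : forall (x y z : B) (v : hom1 y z) (u : hom1 x y),
    hom2 (m1 f_map2 v * m1 f_map2 u) (m1 f_map2 (v * u));
  phiV : forall (x y z : B) (v : hom1 y z) (u : hom1 x y),
    hom2 (m1 f_map2 (v * u)) (m1 f_map2 v * m1 f_map2 u);
  phi0 : forall x : B, hom2 (id1 (m0 f_map2 x)) (m1 f_map2 (id1 x));
  phi0V : forall x : B, hom2 (m1 f_map2 (id1 x)) (id1 (m0 f_map2 x))
}.
Arguments f_map2 {B C} f.
Arguments phi {B C} f {x y z} v u.
Arguments phiV {B C} f {x y z} v u.
Arguments phi0 {B C} f x.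
Arguments phi0V {B C} f x.

Unset Primitive Projections.
Record is_functor (B C : bicat_data) (F : functor_data B C) : Prop :=
IsFunctor {
  functor_id2 : forall (x y : B) (u : hom1 x y), m2 F (id2 u) = id2 (m1 F u);
  functor_vcomp : forall (x y : B) (u v w : hom1 x y)
    (t : hom2 v w) (s : hom2 u v), m2 F (t ∘ s) = m2 F t ∘ m2 F s;
  phi_nat : forall (x y z : B) (v v' : hom1 y z) (u u' : hom1 x y)
    (t : hom2 v v') (s : hom2 u u'),
    phi F v' u' ∘ (m2 F t ⋆ m2 F s) = m2 F (t ⋆ s) ∘ phi F v u;
  phi_inv : forall (x y z : B) (v : hom1 y z) (u : hom1 x y),
    inverse2 (phi F v u) (phiV F v u);
  phi0_inv : forall x : B, inverse2 (phi0 F x) (phi0V F x);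
  phi_assoc : forall (w x y z : B) (h : hom1 y z) (g : hom1 x y) (f : hom1 w x),
    m2 F (assoc h g f) ∘ (phi F (h * g) f ∘ (phi F h g ⋆ id2 (m1 F f)))
    = phi F h (g * f) ∘ ((id2 (m1 F h) ⋆ phi F g f)
        ∘ assoc (m1 F h) (m1 F g) (m1 F f));
  phi_lun : forall (x y : B) (u : hom1 x y),
    m2 F (lun u) ∘ (phi F (id1 y) u ∘ (phi0 F y ⋆ id2 (m1 F u)))
    = lun (m1 F u);
  phi_run : forall (x y : B) (u : hom1 x y),
    m2 F (run u) ∘ (phi F u (id1 x) ∘ (id2 (m1 F u) ⋆ phi0 F x))
    = run (m1 F u)
}.
Set Primitive Projections.

Definition id_map1 (B : bicat_data) : map1 B B :=
  {| m0 := fun x => x; m1 := fun _ _ u => u |}.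

Definition id_functor (B : bicat_data) : functor_data B B := {|
  f_map2 := {| m_map1 := id_map1 B; m2 := fun _ _ _ _ s => s |};
  phi := fun _ _ _ v u => id2 (v * u);
  phiV := fun _ _ _ v u => id2 (v * u);
  phi0 := fun x => id2 (id1 x);
  phi0V := fun x => id2 (id1 x)
|}.

Definition comp_map1 (B C D : bicat_data) (G : map1 C D) (F : map1 B C) :
    map1 B D :=
  {| m0 := fun x => G (F x); m1 := fun _ _ u => m1 G (m1 F u) |}.

Definition comp_functor (B C D : bicat_data) (G : functor_data C D)
    (F : functor_data B C) : functor_data B D := {|
  f_map2 := {| m_map1 := comp_map1 G F;
               m2 := fun _ _ _ _ s => m2 G (m2 F s) |};
  phi := fun _ _ _ v u => m2 G (phi F v u) ∘ phi G (m1 F v) (m1 F u);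
  phiV := fun _ _ _ v u => phiV G (m1 F v) (m1 F u) ∘ m2 G (phiV F v u);
  phi0 := fun x => m2 G (phi0 F x) ∘ phi0 G (F x);
  phi0V := fun x => phi0V G (F x) ∘ m2 G (phi0V F x)
|}.

Definition prod_map1 (B B' C C' : bicat_data) (F : map1 B C) (G : map1 B' C') :
    map1 (B × B') (C × C') :=
  {| m0 := fun x : B × B' => ⟨F (p1 x), G (p2 x)⟩ : C × C';
     m1 := fun _ _ u => ⟨m1 F (p1 u), m1 G (p2 u)⟩ |}.

Definition prod_functor (B B' C C' : bicat_data) (F : functor_data B C)
    (G : functor_data B' C') : functor_data (B × B') (C × C') := {|
  f_map2 := {| m_map1 := prod_map1 F G;
               m2 := fun _ _ _ _ s => ⟨m2 F (p1 s), m2 G (p2 s)⟩ |};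
  phi := fun _ _ _ v u => ⟨phi F (p1 v) (p1 u), phi G (p2 v) (p2 u)⟩;
  phiV := fun _ _ _ v u => ⟨phiV F (p1 v) (p1 u), phiV G (p2 v) (p2 u)⟩;
  phi0 := fun x => ⟨phi0 F (p1 x), phi0 G (p2 x)⟩;
  phi0V := fun x => ⟨phi0V F (p1 x), phi0V G (p2 x)⟩
|}.

Definition pairing_map1 (B C D : bicat_data) (F : map1 B C) (G : map1 B D) :
    map1 B (C × D) :=
  {| m0 := fun x => ⟨F x, G x⟩ : C × D;
     m1 := fun _ _ u => ⟨m1 F u, m1 G u⟩ |}.

Definition pairing_functor (B C D : bicat_data) (F : functor_data B C)
    (G : functor_data B D) : functor_data B (C × D) := {|
  f_map2 := {| m_map1 := pairing_map1 F G;
               m2 := fun _ _ _ _ s => ⟨m2 F s, m2 G s⟩ |};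
  phi := fun _ _ _ v u => ⟨phi F v u, phi G v u⟩;
  phiV := fun _ _ _ v u => ⟨phiV F v u, phiV G v u⟩;
  phi0 := fun x => ⟨phi0 F x, phi0 G x⟩;
  phi0V := fun x => ⟨phi0V F x, phi0V G x⟩
|}.

Definition to_one (B : bicat_data) : functor_data B one_bicat := {|
  f_map2 := {| m_map1 := {| m0 := fun _ => tt : one_bicat; m1 := fun _ _ _ => tt |};
               m2 := fun _ _ _ _ _ => tt |};
  phi := fun _ _ _ _ _ => tt;
  phiV := fun _ _ _ _ _ => tt;
  phi0 := fun _ => tt;
  phi0V := fun _ => tt
|}.

Definition reassoc_map1 (B C D : bicat_data) : map1 (B × C × D) (B × (C × D)) :=
  {| m0 := fun x : B × C × D =>
       ⟨p1 (p1 x), ⟨p2 (p1 x), p2 x⟩⟩ : B × (C × D);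
     m1 := fun _ _ u => ⟨p1 (p1 u), ⟨p2 (p1 u), p2 u⟩⟩ |}.

Definition reassoc (B C D : bicat_data) :
    functor_data (B × C × D) (B × (C × D)) := {|
  f_map2 := {| m_map1 := reassoc_map1 B C D;
               m2 := fun _ _ _ _ s => ⟨p1 (p1 s), ⟨p2 (p1 s), p2 s⟩⟩ |};
  phi := fun _ _ _ v u => id2 (m1 (reassoc_map1 B C D) (v * u));
  phiV := fun _ _ _ v u => id2 (m1 (reassoc_map1 B C D) (v * u));
  phi0 := fun x => id2 (m1 (reassoc_map1 B C D) (id1 x));
  phi0V := fun x => id2 (m1 (reassoc_map1 B C D) (id1 x))
|}.

(* The data of a weak transformation and of a modification only involve the
   action of the functors on objects and 1-cells.  [natV] is the inverse of
   the naturality cell [nat]. *)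
Record trans_data (B C : bicat_data) (F G : map1 B C) := TransData {
  t0 :> forall x : B, hom1 (F x) (G x);
  nat : forall (x y : B) (u : hom1 x y), hom2 (t0 y * m1 F u) (m1 G u * t0 x);
  natV : forall (x y : B) (u : hom1 x y), hom2 (m1 G u * t0 x) (t0 y * m1 F u)
}.
Arguments t0 {B C F G} t x.
Arguments nat {B C F G} t {x y} u.
Arguments natV {B C F G} t {x y} u.

Unset Primitive Projections.
Record is_trans (B C : bicat_data) (F G : functor_data B C)
    (σ : trans_data F G) : Prop := IsTrans {
  nat_inv : forall (x y : B) (u : hom1 x y), inverse2 (nat σ u) (natV σ u);
  nat_nat : forall (x y : B) (u v : hom1 x y) (s : hom2 u v),
    nat σ v ∘ (id2 (σ y) ⋆ m2 F s) = (m2 G s ⋆ id2 (σ x)) ∘ nat σ u;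
  nat_comp : forall (x y z : B) (v : hom1 y z) (u : hom1 x y),
    nat σ (v * u) ∘ (id2 (σ z) ⋆ phi F v u)
    = (phi G v u ⋆ id2 (σ x))
      ∘ (assocV (m1 G v) (m1 G u) (σ x)
      ∘ ((id2 (m1 G v) ⋆ nat σ u)
      ∘ (assoc (m1 G v) (σ y) (m1 F u)
      ∘ ((nat σ v ⋆ id2 (m1 F u))
      ∘ assocV (σ z) (m1 F v) (m1 F u)))));
  nat_id1 : forall x : B,
    nat σ (id1 x) ∘ (id2 (σ x) ⋆ phi0 F x)
    = (phi0 G x ⋆ id2 (σ x)) ∘ (lunV (σ x) ∘ run (σ x))
}.
Set Primitive Projections.

Definition mod_data (B C : bicat_data) (F G : map1 B C)
    (σ τ : trans_data F G) : Type :=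
  forall x : B, hom2 (σ x) (τ x).

Definition is_mod (B C : bicat_data) (F G : map1 B C) (σ τ : trans_data F G)
    (Γ : mod_data σ τ) : Prop :=
  forall (x y : B) (u : hom1 x y),
    nat τ u ∘ (Γ y ⋆ id2 (m1 F u)) = (id2 (m1 G u) ⋆ Γ x) ∘ nat σ u.

Definition invertible_mod (B C : bicat_data) (F G : map1 B C)
    (σ τ : trans_data F G) (Γ : mod_data σ τ) : Prop :=
  is_mod Γ /\ forall x : B, invertible2 (Γ x).

Definition id_trans (B C : bicat_data) (F : map1 B C) : trans_data F F := {|
  t0 := fun x => id1 (F x);
  nat := fun _ _ u => runV (m1 F u) ∘ lun (m1 F u);
  natV := fun _ _ u => lunV (m1 F u) ∘ run (m1 F u)
|}.

Definition comp_trans (B C : bicat_data) (F G H : map1 B C)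
    (τ : trans_data G H) (σ : trans_data F G) : trans_data F H := {|
  t0 := fun x => τ x * σ x;
  nat := fun x y u =>
    assoc (m1 H u) (τ x) (σ x)
    ∘ ((nat τ u ⋆ id2 (σ x))
    ∘ (assocV (τ y) (m1 G u) (σ x)
    ∘ ((id2 (τ y) ⋆ nat σ u)
    ∘ assoc (τ y) (σ y) (m1 F u))));
  natV := fun x y u =>
    assocV (τ y) (σ y) (m1 F u)
    ∘ ((id2 (τ y) ⋆ natV σ u)
    ∘ (assoc (τ y) (m1 G u) (σ x)
    ∘ ((natV τ u ⋆ id2 (σ x))
    ∘ assocV (m1 H u) (τ x) (σ x))))
|}.

Definition whisker_l (B C D : bicat_data) (H : functor_data C D)
    (F G : map1 B C) (σ : trans_data F G) :
    trans_data (comp_map1 H F) (comp_map1 H G) :=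
  @TransData B D (comp_map1 H F) (comp_map1 H G)
    (fun x => m1 H (σ x))
    (fun x y u =>
       phiV H (m1 G u) (σ x) ∘ (m2 H (nat σ u) ∘ phi H (σ y) (m1 F u)))
    (fun x y u =>
       phiV H (σ y) (m1 F u) ∘ (m2 H (natV σ u) ∘ phi H (m1 G u) (σ x))).

Definition whisker_r (A B C : bicat_data) (F G : map1 B C)
    (σ : trans_data F G) (K : map1 A B) :
    trans_data (comp_map1 F K) (comp_map1 G K) :=
  @TransData A C (comp_map1 F K) (comp_map1 G K)
    (fun x => σ (K x)) (fun _ _ u => nat σ (m1 K u))
    (fun _ _ u => natV σ (m1 K u)).

Definition prod_trans (B B' C C' : bicat_data) (F G : map1 B C)
    (F' G' : map1 B' C') (σ : trans_data F G) (τ : trans_data F' G') :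
    trans_data (prod_map1 F F') (prod_map1 G G') :=
  @TransData (B × B') (C × C') (prod_map1 F F') (prod_map1 G G')
    (fun x => ⟨σ (p1 x), τ (p2 x)⟩)
    (fun _ _ u => ⟨nat σ (p1 u), nat τ (p2 u)⟩)
    (fun _ _ u => ⟨natV σ (p1 u), natV τ (p2 u)⟩).

(* An adjoint equivalence [fwd ⊣ bwd] in the functor bicategory.  Composition
   and equality of modifications are componentwise, so the triangle identities
   are stated componentwise. *)
Record adj_data (B C : bicat_data) (F G : map1 B C) := AdjData {
  fwd : trans_data F G;
  bwd : trans_data G F;
  unt : mod_data (id_trans F) (comp_trans bwd fwd);
  cou : mod_data (comp_trans fwd bwd) (id_trans G)
}.
Arguments fwd {B C F G} a.
Arguments bwd {B C F G} a.
Arguments unt {B C F G} a x.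
Arguments cou {B C F G} a x.

Unset Primitive Projections.
Record is_adj_equiv (B C : bicat_data) (F G : functor_data B C)
    (A : adj_data F G) : Prop := IsAdjEquiv {
  fwd_trans : is_trans (F := F) (G := G) (fwd A);
  bwd_trans : is_trans (F := G) (G := F) (bwd A);
  unt_mod : invertible_mod (unt A);
  cou_mod : invertible_mod (cou A);
  fwd_triangle : forall x : B,
    lun (fwd A x)
      ∘ ((cou A x ⋆ id2 (fwd A x))
      ∘ (assocV (fwd A x) (bwd A x) (fwd A x)
      ∘ ((id2 (fwd A x) ⋆ unt A x)
      ∘ runV (fwd A x)))) = id2 (fwd A x);
  bwd_triangle : forall x : B,
    run (bwd A x)
      ∘ ((id2 (bwd A x) ⋆ cou A x)
      ∘ (assoc (bwd A x) (fwd A x) (bwd A x)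
      ∘ ((unt A x ⋆ id2 (bwd A x))
      ∘ lunV (bwd A x)))) = id2 (bwd A x)
}.
Set Primitive Projections.

(* [onmn s t] applies [s], from a composite of [m] 1-cells to a composite of
   [n] 1-cells, to the leftmost [m] factors of a right-nested composite with
   remaining factors [t]. *)
Section Pasting.
Variable B : bicat_data.

Definition reassoc3 (x0 x1 x2 x3 x4 : B) (u3 : hom1 x3 x4) (u2 : hom1 x2 x3)
    (u1 : hom1 x1 x2) (t : hom1 x0 x1) :
    hom2 (u3 * (u2 * (u1 * t))) ((u3 * (u2 * u1)) * t) :=
  assocV u3 (u2 * u1) t ∘ (id2 u3 ⋆ assocV u2 u1 t).

Definition on32 (x0 x1 x2 x3 x4 y : B) (u3 : hom1 x3 x4) (u2 : hom1 x2 x3)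
    (u1 : hom1 x1 x2) (v2 : hom1 y x4) (v1 : hom1 x1 y)
    (s : hom2 (u3 * (u2 * u1)) (v2 * v1)) (t : hom1 x0 x1) :
    hom2 (u3 * (u2 * (u1 * t))) (v2 * (v1 * t)) :=
  assoc v2 v1 t ∘ ((s ⋆ id2 t) ∘ reassoc3 u3 u2 u1 t).

Definition on30 (x0 x1 x2 x3 : B) (u3 : hom1 x3 x1) (u2 : hom1 x2 x3)
    (u1 : hom1 x1 x2)
    (s : hom2 (u3 * (u2 * u1)) (id1 x1)) (t : hom1 x0 x1) :
    hom2 (u3 * (u2 * (u1 * t))) t :=
  lun t ∘ ((s ⋆ id2 t) ∘ reassoc3 u3 u2 u1 t).

Definition on22 (x0 x1 x2 x3 y : B) (u2 : hom1 x2 x3) (u1 : hom1 x1 x2)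
    (v2 : hom1 y x3) (v1 : hom1 x1 y)
    (s : hom2 (u2 * u1) (v2 * v1)) (t : hom1 x0 x1) :
    hom2 (u2 * (u1 * t)) (v2 * (v1 * t)) :=
  assoc v2 v1 t ∘ ((s ⋆ id2 t) ∘ assocV u2 u1 t).

Definition on12 (x0 x1 x2 y : B) (u : hom1 x1 x2)
    (v2 : hom1 y x2) (v1 : hom1 x1 y)
    (s : hom2 u (v2 * v1)) (t : hom1 x0 x1) :
    hom2 (u * t) (v2 * (v1 * t)) :=
  assoc v2 v1 t ∘ (s ⋆ id2 t).

End Pasting.

Section ConstraintTypes.
Variables (ob : Type) (hom : ob -> ob -> bicat_data).
Variable I : forall a, functor_data one_bicat (hom a a).
Variable T : forall a b c, functor_data (hom b c × hom a b) (hom a c).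

(* (h,g,f) |-> (h⊗g)⊗f  and  (h,g,f) |-> h⊗(g⊗f) *)
Definition tens_l (a b c d : ob) :
    functor_data (hom c d × hom b c × hom a b) (hom a d) :=
  comp_functor (T a b d) (prod_functor (T b c d) (id_functor (hom a b))).
Definition tens_r (a b c d : ob) :
    functor_data (hom c d × hom b c × hom a b) (hom a d) :=
  comp_functor (T a c d)
    (comp_functor (prod_functor (id_functor (hom c d)) (T a b c))
      (reassoc (hom c d) (hom b c) (hom a b))).

(* f |-> (1_b, f)  and  f |-> (f, 1_a) *)
Definition add_unit_l (a b : ob) : functor_data (hom a b) (hom b b × hom a b) :=
  pairing_functor (comp_functor (I b) (to_one (hom a b))) (id_functor (hom a b)).
Definition add_unit_r (a b : ob) : functor_data (hom a b) (hom a b × hom a a) :=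
  pairing_functor (id_functor (hom a b)) (comp_functor (I a) (to_one (hom a b))).

Definition tens_unit_l (a b : ob) : functor_data (hom a b) (hom a b) :=
  comp_functor (T a b b) (add_unit_l a b).
Definition tens_unit_r (a b : ob) : functor_data (hom a b) (hom a b) :=
  comp_functor (T a a b) (add_unit_r a b).

Variable A : forall a b c d, adj_data (tens_l a b c d) (tens_r a b c d).
Variable L : forall a b, adj_data (tens_unit_l a b) (id_functor (hom a b)).
Variable R : forall a b, adj_data (tens_unit_r a b) (id_functor (hom a b)).

(* The components of [pi_src] and [pi_tgt] at (k,j,h,g) are
     (1_k⊗a_{jhg}) * (a_{k,jh,g} * (a_{kjh}⊗1_g))   and
     a_{k,j,hg} * a_{kj,h,g}. *)
Definition pi_src (a b c d e : ob) :=
  comp_trans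
    (whisker_r
      (whisker_l (T a d e)
        (prod_trans (id_trans (id_map1 (hom d e))) (fwd (A a b c d))))
      (comp_map1 (reassoc (hom d e) (hom c d × hom b c) (hom a b))
        (prod_map1 (reassoc (hom d e) (hom c d) (hom b c))
           (id_map1 (hom a b)))))
    (comp_trans
      (whisker_r (fwd (A a b d e))
        (prod_map1
          (comp_map1 (prod_map1 (id_map1 (hom d e)) (T b c d))
            (reassoc (hom d e) (hom c d) (hom b c)))
          (id_map1 (hom a b))))
      (whisker_l (T a b e)
        (prod_trans (fwd (A b c d e)) (id_trans (id_map1 (hom a b)))))).

Definition pi_tgt (a b c d e : ob) :=
  comp_trans
    (whisker_r (fwd (A a c d e))
      (comp_map1 (prod_map1 (id_map1 (hom d e × hom c d)) (T a b c))
        (reassoc (hom d e × hom c d) (hom b c) (hom a b))))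
    (whisker_r (fwd (A a b c e))
      (prod_map1 (prod_map1 (T c d e) (id_map1 (hom b c)))
        (id_map1 (hom a b)))).

(* At (g,f): (1_g⊗l_f) * (a_{g,1,f} * (r^■_g⊗1_f))  and  1_{g⊗f}. *)
Definition mu_src (a b c : ob) :=
  comp_trans
    (whisker_l (T a b c)
      (prod_trans (id_trans (id_map1 (hom b c))) (fwd (L a b))))
    (comp_trans
      (whisker_r (fwd (A a b b c))
        (prod_map1 (add_unit_r b c) (id_map1 (hom a b))))
      (whisker_l (T a b c)
        (prod_trans (bwd (R b c)) (id_trans (id_map1 (hom a b)))))).

Definition mu_tgt (a b c : ob) := id_trans (T a b c).

(* At (g,f): l_g⊗1_f  and  l_{g⊗f} * a_{1,g,f}. *)
Definition lambda_src (a b c : ob) :=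
  whisker_l (T a b c)
    (prod_trans (fwd (L b c)) (id_trans (id_map1 (hom a b)))).

Definition lambda_tgt (a b c : ob) :=
  comp_trans
    (whisker_r (fwd (L a c)) (T a b c))
    (whisker_r (fwd (A a b c c))
      (prod_map1 (add_unit_l b c) (id_map1 (hom a b)))).

(* At (g,f): 1_g⊗r^■_f  and  a_{g,f,1} * r^■_{g⊗f}. *)
Definition rho_src (a b c : ob) :=
  whisker_l (T a b c)
    (prod_trans (id_trans (id_map1 (hom b c))) (bwd (R a b))).

Definition rho_tgt (a b c : ob) :=
  comp_trans
    (whisker_r (fwd (A a a b c))
      (pairing_map1 (id_map1 (hom b c × hom a b))
         (comp_map1 (I a) (to_one (hom b c × hom a b)))))
    (whisker_r (bwd (R a c)) (T a b c)).

End ConstraintTypes.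

Record tricat_data := TricatData {
  ob : Type;
  hom : ob -> ob -> bicat_data;
  uni : forall a, functor_data one_bicat (hom a a);
  ten : forall a b c, functor_data (hom b c × hom a b) (hom a c);
  aeq : forall a b c d, adj_data (tens_l ten a b c d) (tens_r ten a b c d);
  leq : forall a b, adj_data (tens_unit_l uni ten a b) (id_functor (hom a b));
  req : forall a b, adj_data (tens_unit_r uni ten a b) (id_functor (hom a b));
  pi : forall a b c d e, mod_data (pi_src aeq a b c d e) (pi_tgt aeq a b c d e);
  mu : forall a b c, mod_data (mu_src aeq leq req a b c) (mu_tgt ten a b c);
  lambda : forall a b c,
    mod_data (lambda_src leq a b c) (lambda_tgt aeq leq a b c);
  rho : forall a b c, mod_data (rho_src req a b c) (rho_tgt aeq req a b c)
}.
Arguments hom {t} a b.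
Arguments uni {t} a.
Arguments ten {t} a b c.
Arguments aeq {t} a b c d.
Arguments leq {t} a b.
Arguments req {t} a b.
Arguments pi {t} a b c d e x.
Arguments mu {t} a b c x.
Arguments lambda {t} a b c x.
Arguments rho {t} a b c x.

Section TricatCells.
Variable T : tricat_data.
Implicit Types a b c d e p : ob T.

Definition unit1 a : hom a a := uni a tt.
Definition unit2 a : hom1 (unit1 a) (unit1 a) := @m1 _ _ (uni a) tt tt tt.
Definition unit_phi a : hom2 (id1 (unit1 a)) (unit2 a) := phi0 (uni a) tt.

Definition ten1 a b c (g : hom b c) (f : hom a b) : hom a c := ten a b c ⟨g, f⟩.
Local Notation "g ⊗ f" := (ten1 g f) (at level 38, left associativity).

Definition ten2 a b c (g g' : hom b c) (f f' : hom a b)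
    (β : hom1 g g') (α : hom1 f f') : hom1 (g ⊗ f) (g' ⊗ f') :=
  @m1 _ _ (ten a b c) ⟨g, f⟩ ⟨g', f'⟩ ⟨β, α⟩.
Local Notation "β ⊠ α" := (ten2 β α) (at level 38, left associativity).

Definition ten3 a b c (g g' : hom b c) (f f' : hom a b)
    (β β' : hom1 g g') (α α' : hom1 f f') (Π : hom2 β β') (Λ : hom2 α α') :
    hom2 (β ⊠ α) (β' ⊠ α') :=
  @m2 _ _ (ten a b c) ⟨g, f⟩ ⟨g', f'⟩ ⟨β, α⟩ ⟨β', α'⟩ ⟨Π, Λ⟩.
Local Notation "Π ⧆ Λ" := (ten3 Π Λ) (at level 38, left associativity).

Definition ten_phi a b c (g g' g'' : hom b c) (f f' f'' : hom a b)
    (α : hom1 g' g'') (β : hom1 f' f'') (α' : hom1 g g') (β' : hom1 f f') :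
    hom2 ((α ⊠ β) * (α' ⊠ β')) ((α * α') ⊠ (β * β')) :=
  @phi _ _ (ten a b c) ⟨g, f⟩ ⟨g', f'⟩ ⟨g'', f''⟩ ⟨α, β⟩ ⟨α', β'⟩.
Definition ten_phiV a b c (g g' g'' : hom b c) (f f' f'' : hom a b)
    (α : hom1 g' g'') (β : hom1 f' f'') (α' : hom1 g g') (β' : hom1 f f') :
    hom2 ((α * α') ⊠ (β * β')) ((α ⊠ β) * (α' ⊠ β')) :=
  @phiV _ _ (ten a b c) ⟨g, f⟩ ⟨g', f'⟩ ⟨g'', f''⟩ ⟨α, β⟩ ⟨α', β'⟩.
Definition ten_phi0 a b c (g : hom b c) (f : hom a b) :
    hom2 (id1 (g ⊗ f)) (id1 g ⊠ id1 f) := phi0 (ten a b c) ⟨g, f⟩.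
Definition ten_phi0V a b c (g : hom b c) (f : hom a b) :
    hom2 (id1 g ⊠ id1 f) (id1 (g ⊗ f)) := phi0V (ten a b c) ⟨g, f⟩.

Definition asc a b c d (h : hom c d) (g : hom b c) (f : hom a b) :
    hom1 ((h ⊗ g) ⊗ f) (h ⊗ (g ⊗ f)) := fwd (aeq a b c d) ⟨⟨h, g⟩, f⟩.
Definition asc2 a b c d (h h' : hom c d) (g g' : hom b c) (f f' : hom a b)
    (γ : hom1 h h') (β : hom1 g g') (α : hom1 f f') :
    hom2 (asc h' g' f' * ((γ ⊠ β) ⊠ α)) ((γ ⊠ (β ⊠ α)) * asc h g f) :=
  @nat _ _ _ _ (fwd (aeq a b c d)) ⟨⟨h, g⟩, f⟩ ⟨⟨h', g'⟩, f'⟩ ⟨⟨γ, β⟩, α⟩.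
Definition asc2V a b c d (h h' : hom c d) (g g' : hom b c) (f f' : hom a b)
    (γ : hom1 h h') (β : hom1 g g') (α : hom1 f f') :
    hom2 ((γ ⊠ (β ⊠ α)) * asc h g f) (asc h' g' f' * ((γ ⊠ β) ⊠ α)) :=
  @natV _ _ _ _ (fwd (aeq a b c d)) ⟨⟨h, g⟩, f⟩ ⟨⟨h', g'⟩, f'⟩ ⟨⟨γ, β⟩, α⟩.

Definition lft a b (f : hom a b) : hom1 (unit1 b ⊗ f) f := fwd (leq a b) f.
Definition rgtV a b (f : hom a b) : hom1 f (f ⊗ unit1 a) := bwd (req a b) f.

Definition pic a b c d e (k : hom d e) (j : hom c d) (h : hom b c)
    (g : hom a b) :
    hom2 ((id1 k ⊠ asc j h g) * (asc k (j ⊗ h) g * (asc k j h ⊠ id1 g)))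
         (asc k j (h ⊗ g) * asc (k ⊗ j) h g) :=
  pi a b c d e ⟨⟨⟨k, j⟩, h⟩, g⟩.
Definition muc a b c (g : hom b c) (f : hom a b) :
    hom2 ((id1 g ⊠ lft f) * (asc g (unit1 b) f * (rgtV g ⊠ id1 f)))
         (id1 (g ⊗ f)) :=
  mu a b c ⟨g, f⟩.
Definition lamc a b c (g : hom b c) (f : hom a b) :
    hom2 (lft g ⊠ id1 f) (lft (g ⊗ f) * asc (unit1 c) g f) :=
  lambda a b c ⟨g, f⟩.
Definition rhoc a b c (g : hom b c) (f : hom a b) :
    hom2 (id1 g ⊠ rgtV f) (asc g f (unit1 a) * rgtV (g ⊗ f)) :=
  rho a b c ⟨g, f⟩.

Definition tenR_comp a b c (g g' g'' : hom b c) (β : hom1 g' g'')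
    (β' : hom1 g g') (f : hom a b) :
    hom2 ((β ⊠ id1 f) * (β' ⊠ id1 f)) ((β * β') ⊠ id1 f) :=
  (id2 (β * β') ⧆ lun (id1 f)) ∘ ten_phi β (id1 f) β' (id1 f).
Definition tenR_compV a b c (g g' g'' : hom b c) (β : hom1 g' g'')
    (β' : hom1 g g') (f : hom a b) :
    hom2 ((β * β') ⊠ id1 f) ((β ⊠ id1 f) * (β' ⊠ id1 f)) :=
  ten_phiV β (id1 f) β' (id1 f) ∘ (id2 (β * β') ⧆ lunV (id1 f)).
Definition tenL_comp a b c (k : hom b c) (f f' f'' : hom a b)
    (α : hom1 f' f'') (α' : hom1 f f') :
    hom2 ((id1 k ⊠ α) * (id1 k ⊠ α')) (id1 k ⊠ (α * α')) :=
  (lun (id1 k) ⧆ id2 (α * α')) ∘ ten_phi (id1 k) α (id1 k) α'.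
Definition tenL_compV a b c (k : hom b c) (f f' f'' : hom a b)
    (α : hom1 f' f'') (α' : hom1 f f') :
    hom2 (id1 k ⊠ (α * α')) ((id1 k ⊠ α) * (id1 k ⊠ α')) :=
  ten_phiV (id1 k) α (id1 k) α' ∘ (lunV (id1 k) ⧆ id2 (α * α')).

(* s⊗1_f and 1_k⊗s for a 3-morphism s from a composite of m to a composite of
   n 2-morphisms, source and target being distributed over the composites. *)
Definition tenR32 a b c (g0 g1 g2 g3 g4 : hom b c) (u3 : hom1 g2 g3)
    (u2 : hom1 g1 g2) (u1 : hom1 g0 g1) (v2 : hom1 g4 g3) (v1 : hom1 g0 g4)
    (s : hom2 (u3 * (u2 * u1)) (v2 * v1)) (f : hom a b) :
    hom2 ((u3 ⊠ id1 f) * ((u2 ⊠ id1 f) * (u1 ⊠ id1 f)))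
         ((v2 ⊠ id1 f) * (v1 ⊠ id1 f)) :=
  tenR_compV v2 v1 f ∘ ((s ⧆ id2 (id1 f))
    ∘ (tenR_comp u3 (u2 * u1) f ∘ (id2 (u3 ⊠ id1 f) ⋆ tenR_comp u2 u1 f))).

Definition tenL32 a b c (k : hom b c) (f0 f1 f2 f3 f4 : hom a b)
    (u3 : hom1 f2 f3) (u2 : hom1 f1 f2) (u1 : hom1 f0 f1)
    (v2 : hom1 f4 f3) (v1 : hom1 f0 f4)
    (s : hom2 (u3 * (u2 * u1)) (v2 * v1)) :
    hom2 ((id1 k ⊠ u3) * ((id1 k ⊠ u2) * (id1 k ⊠ u1)))
         ((id1 k ⊠ v2) * (id1 k ⊠ v1)) :=
  tenL_compV k v2 v1 ∘ ((id2 (id1 k) ⧆ s)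
    ∘ (tenL_comp k u3 (u2 * u1) ∘ (id2 (id1 k ⊠ u3) ⋆ tenL_comp k u2 u1))).

Definition tenR30 a b c (g0 g1 g2 : hom b c) (u3 : hom1 g2 g0)
    (u2 : hom1 g1 g2) (u1 : hom1 g0 g1)
    (s : hom2 (u3 * (u2 * u1)) (id1 g0)) (f : hom a b) :
    hom2 ((u3 ⊠ id1 f) * ((u2 ⊠ id1 f) * (u1 ⊠ id1 f))) (id1 (g0 ⊗ f)) :=
  ten_phi0V g0 f ∘ ((s ⧆ id2 (id1 f))
    ∘ (tenR_comp u3 (u2 * u1) f ∘ (id2 (u3 ⊠ id1 f) ⋆ tenR_comp u2 u1 f))).

Definition tenL30 a b c (k : hom b c) (f0 f1 f2 : hom a b)
    (u3 : hom1 f2 f0) (u2 : hom1 f1 f2) (u1 : hom1 f0 f1)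
    (s : hom2 (u3 * (u2 * u1)) (id1 f0)) :
    hom2 ((id1 k ⊠ u3) * ((id1 k ⊠ u2) * (id1 k ⊠ u1))) (id1 (k ⊗ f0)) :=
  ten_phi0V k f0 ∘ ((id2 (id1 k) ⧆ s)
    ∘ (tenL_comp k u3 (u2 * u1) ∘ (id2 (id1 k ⊠ u3) ⋆ tenL_comp k u2 u1))).

Definition tenR12 a b c (g0 g1 g2 : hom b c) (u : hom1 g0 g1)
    (v2 : hom1 g2 g1) (v1 : hom1 g0 g2) (s : hom2 u (v2 * v1)) (f : hom a b) :
    hom2 (u ⊠ id1 f) ((v2 ⊠ id1 f) * (v1 ⊠ id1 f)) :=
  tenR_compV v2 v1 f ∘ (s ⧆ id2 (id1 f)).

Definition tenL12 a b c (k : hom b c) (f0 f1 f2 : hom a b) (u : hom1 f0 f1)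
    (v2 : hom1 f2 f1) (v1 : hom1 f0 f2) (s : hom2 u (v2 * v1)) :
    hom2 (id1 k ⊠ u) ((id1 k ⊠ v2) * (id1 k ⊠ v1)) :=
  tenL_compV k v2 v1 ∘ (id2 (id1 k) ⧆ s).

(* Naturality of the associator in one argument, the two other arguments being
   identities; [ten_phi0V] identifies 1_g⊗1_f with 1_{g⊗f}. *)
Definition asc_nat1 a b c d (h h' : hom c d) (α : hom1 h h')
    (g : hom b c) (f : hom a b) :
    hom2 (asc h' g f * ((α ⊠ id1 g) ⊠ id1 f))
         ((α ⊠ id1 (g ⊗ f)) * asc h g f) :=
  ((id2 α ⧆ ten_phi0V g f) ⋆ id2 (asc h g f)) ∘ asc2 α (id1 g) (id1 f).

Definition asc_nat2 a b c d (h : hom c d) (g g' : hom b c) (α : hom1 g g')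
    (f : hom a b) :
    hom2 (asc h g' f * ((id1 h ⊠ α) ⊠ id1 f))
         ((id1 h ⊠ (α ⊠ id1 f)) * asc h g f) :=
  asc2 (id1 h) α (id1 f).

Definition asc_nat2V a b c d (h : hom c d) (g g' : hom b c) (α : hom1 g g')
    (f : hom a b) :
    hom2 ((id1 h ⊠ (α ⊠ id1 f)) * asc h g f)
         (asc h g' f * ((id1 h ⊠ α) ⊠ id1 f)) :=
  asc2V (id1 h) α (id1 f).

Definition asc_nat3V a b c d (h : hom c d) (g : hom b c) (f f' : hom a b)
    (α : hom1 f f') :
    hom2 ((id1 h ⊠ (id1 g ⊠ α)) * asc h g f)
         (asc h g f' * (id1 (h ⊗ g) ⊠ α)) :=
  (id2 (asc h g f') ⋆ (ten_phi0V h g ⧆ id2 α)) ∘ asc2V (id1 h) (id1 g) α.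

(* Nonabelian 4-cocycle condition: the two pastings over the associahedron
   from the path through ((k(jh))g)f, (k((jh)g))f, (k(j(hg)))f, k((j(hg))f),
   k(j((hg)f)) to the path through ((kj)h)(gf), (kj)(h(gf)). *)
Definition cocycle_left a b c d e p (k : hom e p) (j : hom d e) (h : hom c d)
    (g : hom b c) (f : hom a b) :=
  let u6 := id1 k ⊠ (id1 j ⊠ asc h g f) in
  let u5 := id1 k ⊠ asc j (h ⊗ g) f in
  let u4 := asc k (j ⊗ (h ⊗ g)) f in
  (id2 (asc k j (h ⊗ (g ⊗ f))) ⋆ pic (k ⊗ j) h g f)
  ∘ (on22 (asc_nat3V k j (asc h g f))
       (asc (k ⊗ j) (h ⊗ g) f * (asc (k ⊗ j) h g ⊠ id1 f))
  ∘ ((id2 u6 ⋆ on32 (pic k j (h ⊗ g) f) (asc (k ⊗ j) h g ⊠ id1 f))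
  ∘ (id2 u6 ⋆ (id2 u5 ⋆ (id2 u4 ⋆ tenR32 (pic k j h g) f))))).

Definition cocycle_right a b c d e p (k : hom e p) (j : hom d e) (h : hom c d)
    (g : hom b c) (f : hom a b) :=
  let u6 := id1 k ⊠ (id1 j ⊠ asc h g f) in
  let u5 := id1 k ⊠ asc j (h ⊗ g) f in
  let u2 := asc k (j ⊗ h) g ⊠ id1 f in
  let u1 := (asc k j h ⊠ id1 g) ⊠ id1 f in
  let v := id1 k ⊠ asc j h (g ⊗ f) in
  on32 (pic k j h (g ⊗ f)) (asc ((k ⊗ j) ⊗ h) g f)
  ∘ ((id2 v ⋆ (id2 (asc k (j ⊗ h) (g ⊗ f)) ⋆ asc_nat1 (asc k j h) g f))
  ∘ ((id2 v ⋆ on32 (pic k (j ⊗ h) g f) u1)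
  ∘ (on32 (tenL32 k (pic j h g f)) (asc k ((j ⊗ h) ⊗ g) f * (u2 * u1))
  ∘ (id2 u6 ⋆ (id2 u5 ⋆ on22 (asc_nat2 k (asc j h g) f) (u2 * u1)))))).

(* Left normalization: the two pastings from
     a_{hgf} * (((1_h⊗l_g)⊗1_f) * ((a_{h1g}⊗1_f) * ((r^■_h⊗1_g)⊗1_f)))
   to a_{hgf}. *)
Definition left_norm_left a b c d (h : hom c d) (g : hom b c) (f : hom a b) :=
  let u1 := (rgtV h ⊠ id1 g) ⊠ id1 f in
  let u2 := asc h (unit1 c) g ⊠ id1 f in
  let v := id1 h ⊠ lft (g ⊗ f) in
  on30 (muc h (g ⊗ f)) (asc h g f)
  ∘ ((id2 v ⋆ (id2 (asc h (unit1 c) (g ⊗ f)) ⋆ asc_nat1 (rgtV h) g f))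
  ∘ ((id2 v ⋆ on32 (pic h (unit1 c) g f) u1)
  ∘ (on12 (tenL12 h (lamc g f)) (asc h (unit1 c ⊗ g) f * (u2 * u1))
  ∘ on22 (asc_nat2 h (lft g) f) (u2 * u1)))).

Definition left_norm_right a b c d (h : hom c d) (g : hom b c) (f : hom a b) :=
  run (asc h g f) ∘ (id2 (asc h g f) ⋆ tenR30 (muc h g) f).

(* Right normalization: the two pastings from
     (1_h⊗(1_g⊗l_f)) * ((1_h⊗a_{g1f}) * ((1_h⊗(r^■_g⊗1_f)) * a_{hgf}))
   to a_{hgf}. *)
Definition right_norm_left a b c d (h : hom c d) (g : hom b c) (f : hom a b) :=
  let u4 := id1 h ⊠ (id1 g ⊠ lft f) in
  let u3 := id1 h ⊠ asc g (unit1 b) f in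
  let v := rgtV (h ⊗ g) ⊠ id1 f in
  run (asc h g f)
  ∘ ((id2 (asc h g f) ⋆ muc (h ⊗ g) f)
  ∘ (on22 (asc_nat3V h g (lft f)) (asc (h ⊗ g) (unit1 b) f * v)
  ∘ ((id2 u4 ⋆ on32 (pic h g (unit1 b) f) v)
  ∘ ((id2 u4 ⋆ (id2 u3 ⋆ (id2 (asc h (g ⊗ unit1 b) f) ⋆ tenR12 (rhoc h g) f)))
  ∘ (id2 u4 ⋆ (id2 u3 ⋆ asc_nat2V h (rgtV g) f)))))).

Definition right_norm_right a b c d (h : hom c d) (g : hom b c) (f : hom a b) :=
  on30 (tenL30 h (muc g f)) (asc h g f).

End TricatCells.

Unset Primitive Projections.
Record is_tricat (T : tricat_data) : Prop := IsTricat {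
  hom_bicat : forall a b : ob T, is_bicat (hom a b);
  uni_functor : forall a : ob T, is_functor (uni a);
  ten_functor : forall a b c : ob T, is_functor (ten a b c);
  aeq_equiv : forall a b c d : ob T, is_adj_equiv (F := tens_l ten a b c d)
    (G := tens_r ten a b c d) (aeq a b c d);
  leq_equiv : forall a b : ob T, is_adj_equiv (F := tens_unit_l uni ten a b)
    (G := id_functor (hom a b)) (leq a b);
  req_equiv : forall a b : ob T, is_adj_equiv (F := tens_unit_r uni ten a b)
    (G := id_functor (hom a b)) (req a b);
  pi_mod : forall a b c d e : ob T, invertible_mod (pi a b c d e);
  mu_mod : forall a b c : ob T, invertible_mod (mu a b c);
  lambda_mod : forall a b c : ob T, invertible_mod (lambda a b c);
  rho_mod : forall a b c : ob T, invertible_mod (rho a b c);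
  cocycle : forall (a b c d e p : ob T) (k : hom e p) (j : hom d e)
    (h : hom c d) (g : hom b c) (f : hom a b),
    cocycle_left k j h g f = cocycle_right k j h g f;
  left_norm : forall (a b c d : ob T) (h : hom c d) (g : hom b c) (f : hom a b),
    left_norm_left h g f = left_norm_right h g f;
  right_norm : forall (a b c d : ob T) (h : hom c d) (g : hom b c) (f : hom a b),
    right_norm_left h g f = right_norm_right h g f
}.
Set Primitive Projections.

Definition is_biequivalence1 (T : tricat_data) (a b : ob T) (f : hom a b) :
    Prop :=
  exists g : hom b a,
    equivalent0 (ten1 g f) (unit1 a) /\ equivalent0 (ten1 f g) (unit1 b).

(* Equality of cells whose sources and targets are not convertible: equality
   of the cells together with their boundaries. *)
Inductive eq1 (B : bicat_data) (x y : B) (u : hom1 x y) :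
    forall x' y' : B, hom1 x' y' -> Prop :=
  eq1_refl : eq1 u u.

Inductive eq2 (B : bicat_data) (x y : B) (u v : hom1 x y) (s : hom2 u v) :
    forall (x' y' : B) (u' v' : hom1 x' y'), hom2 u' v' -> Prop :=
  eq2_refl : eq2 s s.

Unset Primitive Projections.
Record is_strict (B C : bicat_data) (F : map2 B C) : Prop := IsStrict {
  strict_id1 : forall x : B, m1 F (id1 x) = id1 (F x);
  strict_comp : forall (x y z : B) (v : hom1 y z) (u : hom1 x y),
    m1 F (v * u) = m1 F v * m1 F u;
  strict_id2 : forall (x y : B) (u : hom1 x y), m2 F (id2 u) = id2 (m1 F u);
  strict_vcomp : forall (x y : B) (u v w : hom1 x y)
    (t : hom2 v w) (s : hom2 u v), m2 F (t ∘ s) = m2 F t ∘ m2 F s;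
  strict_hcomp : forall (x y z : B) (v v' : hom1 y z) (u u' : hom1 x y)
    (t : hom2 v v') (s : hom2 u u'), eq2 (m2 F (t ⋆ s)) (m2 F t ⋆ m2 F s);
  strict_assoc : forall (w x y z : B) (h : hom1 y z) (g : hom1 x y)
    (f : hom1 w x),
    eq2 (m2 F (assoc h g f)) (assoc (m1 F h) (m1 F g) (m1 F f));
  strict_lun : forall (x y : B) (u : hom1 x y),
    eq2 (m2 F (lun u)) (lun (m1 F u));
  strict_run : forall (x y : B) (u : hom1 x y),
    eq2 (m2 F (run u)) (run (m1 F u))
}.

Record is_biequivalence (B C : bicat_data) (F : map2 B C) : Prop :=
IsBiequivalence {
  biequiv_obj : forall y : C, exists x : B, equivalent0 (F x) y;
  biequiv_hom1 : forall (x x' : B) (v : hom1 (F x) (F x')),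
    exists u : hom1 x x', isomorphic1 (m1 F u) v;
  biequiv_hom2 : forall (x x' : B) (u v : hom1 x x')
    (t : hom2 (m1 F u) (m1 F v)), exists! s : hom2 u v, m2 F s = t
}.

(* [Q] sends the components of a transformation, modification or adjunction
   at a cell x to the components of another one at the cell [P x]. *)
Record preserves_trans (X X' C C' : bicat_data) (P : map1 X X')
    (Q : map2 C C') (F G : map1 X C) (σ : trans_data F G) (F' G' : map1 X' C')
    (σ' : trans_data F' G') : Prop := PreservesTrans {
  preserves_t0 : forall x : X, eq1 (m1 Q (σ x)) (σ' (P x));
  preserves_nat : forall (x y : X) (u : hom1 x y),
    eq2 (m2 Q (nat σ u)) (nat σ' (m1 P u))
}.

Definition preserves_mod (X X' C C' : bicat_data) (P : map1 X X')
    (Q : map2 C C') (F G : map1 X C) (σ τ : trans_data F G) (Γ : mod_data σ τ)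
    (F' G' : map1 X' C') (σ' τ' : trans_data F' G') (Γ' : mod_data σ' τ') :
    Prop :=
  forall x : X, eq2 (m2 Q (Γ x)) (Γ' (P x)).

Record preserves_adj (X X' C C' : bicat_data) (P : map1 X X')
    (Q : map2 C C') (F G : map1 X C) (A : adj_data F G) (F' G' : map1 X' C')
    (A' : adj_data F' G') : Prop := PreservesAdj {
  preserves_fwd : preserves_trans P Q (fwd A) (fwd A');
  preserves_bwd : preserves_trans P Q (bwd A) (bwd A');
  preserves_unt : preserves_mod P Q (unt A) (unt A');
  preserves_cou : preserves_mod P Q (cou A) (cou A')
}.
Set Primitive Projections.

(* Assignments on objects, 1-, 2- and 3-morphisms. *)
Record trimap (S T : tricat_data) := Trimap {
  tm_ob :> ob S -> ob T;
  tm_hom : forall a b : ob S, map2 (hom a b) (hom (tm_ob a) (tm_ob b))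
}.
Arguments tm_ob {S T} t a.
Arguments tm_hom {S T} t a b.

Unset Primitive Projections.
Record is_virtually_strict (S T : tricat_data) (F : trimap S T) : Prop :=
IsVirtuallyStrict {
  vs_hom : forall a b : ob S, is_strict (tm_hom F a b);
  vs_ten1 : forall (a b c : ob S) (g : hom b c) (f : hom a b),
    tm_hom F a c (ten1 g f) = ten1 (tm_hom F b c g) (tm_hom F a b f);
  vs_ten2 : forall (a b c : ob S) (g g' : hom b c) (f f' : hom a b)
    (β : hom1 g g') (α : hom1 f f'),
    eq1 (m1 (tm_hom F a c) (ten2 β α))
        (ten2 (m1 (tm_hom F b c) β) (m1 (tm_hom F a b) α));
  vs_ten3 : forall (a b c : ob S) (g g' : hom b c) (f f' : hom a b)
    (β β' : hom1 g g') (α α' : hom1 f f') (Π : hom2 β β') (Λ : hom2 α α'),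
    eq2 (m2 (tm_hom F a c) (ten3 Π Λ))
        (ten3 (m2 (tm_hom F b c) Π) (m2 (tm_hom F a b) Λ));
  vs_unit1 : forall a : ob S, tm_hom F a a (unit1 a) = unit1 (F a);
  vs_unit2 : forall a : ob S, eq1 (m1 (tm_hom F a a) (unit2 a)) (unit2 (F a));
  vs_unit_phi : forall a : ob S,
    eq2 (m2 (tm_hom F a a) (unit_phi a)) (unit_phi (F a));
  vs_ten_phi : forall (a b c : ob S) (g g' g'' : hom b c) (f f' f'' : hom a b)
    (α : hom1 g' g'') (β : hom1 f' f'') (α' : hom1 g g') (β' : hom1 f f'),
    eq2 (m2 (tm_hom F a c) (ten_phi α β α' β'))
        (ten_phi (m1 (tm_hom F b c) α) (m1 (tm_hom F a b) β)
                 (m1 (tm_hom F b c) α') (m1 (tm_hom F a b) β'));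
  vs_ten_phi0 : forall (a b c : ob S) (g : hom b c) (f : hom a b),
    eq2 (m2 (tm_hom F a c) (ten_phi0 g f))
        (ten_phi0 (tm_hom F b c g) (tm_hom F a b f));
  vs_aeq : forall a b c d : ob S,
    preserves_adj
      (prod_map1 (prod_map1 (tm_hom F c d) (tm_hom F b c)) (tm_hom F a b))
      (tm_hom F a d) (aeq a b c d) (aeq (F a) (F b) (F c) (F d));
  vs_leq : forall a b : ob S,
    preserves_adj (tm_hom F a b) (tm_hom F a b) (leq a b) (leq (F a) (F b));
  vs_req : forall a b : ob S,
    preserves_adj (tm_hom F a b) (tm_hom F a b) (req a b) (req (F a) (F b));
  vs_pi : forall a b c d e : ob S,
    preserves_mod
      (prod_map1
        (prod_map1 (prod_map1 (tm_hom F d e) (tm_hom F c d)) (tm_hom F b c))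
        (tm_hom F a b))
      (tm_hom F a e) (pi a b c d e) (pi (F a) (F b) (F c) (F d) (F e));
  vs_mu : forall a b c : ob S,
    preserves_mod (prod_map1 (tm_hom F b c) (tm_hom F a b)) (tm_hom F a c)
      (mu a b c) (mu (F a) (F b) (F c));
  vs_lambda : forall a b c : ob S,
    preserves_mod (prod_map1 (tm_hom F b c) (tm_hom F a b)) (tm_hom F a c)
      (lambda a b c) (lambda (F a) (F b) (F c));
  vs_rho : forall a b c : ob S,
    preserves_mod (prod_map1 (tm_hom F b c) (tm_hom F a b)) (tm_hom F a c)
      (rho a b c) (rho (F a) (F b) (F c))
}.

Record is_vs_triequivalence (S T : tricat_data) (F : trimap S T) : Prop :=
IsVsTriequivalence {
  vst_functor : is_virtually_strict F;
  vst_obj : forall a' : ob T, exists (a : ob S) (f : hom (F a) a'),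
    is_biequivalence1 f;
  vst_strict : forall a b : ob S, is_strict (tm_hom F a b);
  vst_hom : forall a b : ob S, is_biequivalence (tm_hom F a b)
}.
Set Primitive Projections.

Section Formal.
Variable T : tricat_data.

Inductive fhom1 : ob T -> ob T -> Type :=
  | basic1 (a b : ob T) : hom a b -> fhom1 a b
  | ften1 (a b c : ob T) : fhom1 b c -> fhom1 a b -> fhom1 a c.

Fixpoint ev1 (a b : ob T) (f : fhom1 a b) : hom a b :=
  match f with
  | basic1 f => f
  | ften1 g f => ten1 (ev1 g) (ev1 f)
  end.

Inductive fhom2 : forall a b : ob T, fhom1 a b -> fhom1 a b -> Type :=
  | basic2 (a b : ob T) (f g : fhom1 a b) : hom1 (ev1 f) (ev1 g) -> fhom2 f g
  | ften2 (a b c : ob T) (g1 g2 : fhom1 b c) (f1 f2 : fhom1 a b) :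
      fhom2 g1 g2 -> fhom2 f1 f2 -> fhom2 (ften1 g1 f1) (ften1 g2 f2)
  | fcomp (a b : ob T) (f1 f2 f3 : fhom1 a b) :
      fhom2 f2 f3 -> fhom2 f1 f2 -> fhom2 f1 f3.

Fixpoint ev2 (a b : ob T) (f g : fhom1 a b) (α : fhom2 f g) :
    hom1 (ev1 f) (ev1 g) :=
  match α with
  | basic2 α => α
  | ften2 β α => ten2 (ev2 β) (ev2 α)
  | fcomp β α => ev2 β * ev2 α
  end.

(* The source and target components of the triple (Π, α, β) are carried by
   the type. *)
Definition fhom3 (a b : ob T) (f g : fhom1 a b) (α β : fhom2 f g) : Type :=
  hom2 (ev2 α) (ev2 β).

Definition fhom (a b : ob T) : bicat_data := {|
  obj := fhom1 a b;
  hom1 := fun f g => fhom2 f g;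
  hom2 := fun f g α β => fhom3 α β;
  id1 := fun f => basic2 (id1 (ev1 f));
  comp := fun _ _ _ β α => fcomp β α;
  id2 := fun _ _ α => id2 (ev2 α);
  vcomp := fun _ _ _ _ _ Π Λ => Π ∘ Λ;
  hcomp := fun _ _ _ _ _ _ _ Π Λ => Π ⋆ Λ;
  assoc := fun _ _ _ _ γ β α => assoc (ev2 γ) (ev2 β) (ev2 α);
  assocV := fun _ _ _ _ γ β α => assocV (ev2 γ) (ev2 β) (ev2 α);
  lun := fun _ _ α => lun (ev2 α);
  lunV := fun _ _ α => lunV (ev2 α);
  run := fun _ _ α => run (ev2 α);
  runV := fun _ _ α => runV (ev2 α)
|}.

Definition ev_hom (a b : ob T) : map2 (fhom a b) (hom a b) := {|
  m_map1 := {| m0 := fun f : fhom a b => ev1 f;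
               m1 := fun _ _ α => ev2 α |};
  m2 := fun _ _ _ _ Π => Π
|}.

Definition funi (a : ob T) : functor_data one_bicat (fhom a a) := {|
  f_map2 := {|
    m_map1 := {| m0 := fun _ => basic1 (unit1 a) : fhom a a;
                 m1 := fun _ _ _ =>
                   @basic2 a a (basic1 (unit1 a)) (basic1 (unit1 a)) (unit2 a) |};
    m2 := fun (x y : one_bicat) (u v : hom1 x y) (s : hom2 u v) =>
      @m2 _ _ (uni a) tt tt tt tt (s : Datatypes.unit) |};
  phi := fun _ _ _ _ _ => @phi _ _ (uni a) tt tt tt tt tt;
  phiV := fun _ _ _ _ _ => @phiV _ _ (uni a) tt tt tt tt tt;
  phi0 := fun _ => phi0 (uni a) tt;
  phi0V := fun _ => phi0V (uni a) tt
|}.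

Definition ften (a b c : ob T) :
    functor_data (fhom b c × fhom a b) (fhom a c) := {|
  f_map2 := {|
    m_map1 := {| m0 := fun x : fhom b c × fhom a b =>
                   ften1 (p1 x) (p2 x) : fhom a c;
                 m1 := fun _ _ u => ften2 (p1 u) (p2 u) |};
    m2 := fun _ _ u v s =>
      @ten3 T a b c _ _ _ _ (ev2 (p1 u)) (ev2 (p1 v))
        (ev2 (p2 u)) (ev2 (p2 v)) (p1 s) (p2 s) |};
  phi := fun _ _ _ v u =>
    ten_phi (ev2 (p1 v)) (ev2 (p2 v)) (ev2 (p1 u)) (ev2 (p2 u));
  phiV := fun _ _ _ v u =>
    ten_phiV (ev2 (p1 v)) (ev2 (p2 v)) (ev2 (p1 u)) (ev2 (p2 u));
  phi0 := fun x => ten_phi0 (ev1 (p1 x)) (ev1 (p2 x));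
  phi0V := fun x => ten_phi0V (ev1 (p1 x)) (ev1 (p2 x))
|}.

(* Constraint cells of [T] at the evaluated indices, with formal sources and
   targets given by [F] and [G]. *)
Definition lift_trans (X : bicat_data) (a b : ob T) (F G : map1 X (fhom a b))
    (σ : trans_data (comp_map1 (ev_hom a b) F) (comp_map1 (ev_hom a b) G)) :
    trans_data F G :=
  @TransData X (fhom a b) F G
    (fun x => @basic2 a b (F x) (G x) (σ x))
    (fun _ _ u => nat σ u) (fun _ _ u => natV σ u).

Definition faeq (a b c d : ob T) :
    adj_data (tens_l ften a b c d) (tens_r ften a b c d) :=
  let P := prod_map1 (prod_map1 (ev_hom c d) (ev_hom b c)) (ev_hom a b) in
  {| fwd := lift_trans (F := tens_l ften a b c d) (G := tens_r ften a b c d)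
       (whisker_r (fwd (aeq a b c d)) P);
     bwd := lift_trans (F := tens_r ften a b c d) (G := tens_l ften a b c d)
       (whisker_r (bwd (aeq a b c d)) P);
     unt := fun x => unt (aeq a b c d) (P x);
     cou := fun x => cou (aeq a b c d) (P x) |}.

Definition fleq (a b : ob T) :
    adj_data (tens_unit_l funi ften a b) (id_functor (fhom a b)) :=
  let P := ev_hom a b in
  {| fwd := lift_trans (F := tens_unit_l funi ften a b)
       (G := id_functor (fhom a b)) (whisker_r (fwd (leq a b)) P);
     bwd := lift_trans (F := id_functor (fhom a b))
       (G := tens_unit_l funi ften a b) (whisker_r (bwd (leq a b)) P);
     unt := fun x => unt (leq a b) (P x);
     cou := fun x => cou (leq a b) (P x) |}.

Definition freq (a b : ob T) :
    adj_data (tens_unit_r funi ften a b) (id_functor (fhom a b)) :=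
  let P := ev_hom a b in
  {| fwd := lift_trans (F := tens_unit_r funi ften a b)
       (G := id_functor (fhom a b)) (whisker_r (fwd (req a b)) P);
     bwd := lift_trans (F := id_functor (fhom a b))
       (G := tens_unit_r funi ften a b) (whisker_r (bwd (req a b)) P);
     unt := fun x => unt (req a b) (P x);
     cou := fun x => cou (req a b) (P x) |}.

Definition formal : tricat_data := {|
  ob := ob T;
  hom := fhom;
  uni := funi;
  ten := ften;
  aeq := faeq;
  leq := fleq;
  req := freq;
  pi := fun a b c d e x =>
    pic (ev1 (p1 (p1 (p1 x)))) (ev1 (p2 (p1 (p1 x)))) (ev1 (p2 (p1 x)))
        (ev1 (p2 x));
  mu := fun a b c x => muc (ev1 (p1 x)) (ev1 (p2 x));
  lambda := fun a b c x => lamc (ev1 (p1 x)) (ev1 (p2 x));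
  rho := fun a b c x => rhoc (ev1 (p1 x)) (ev1 (p2 x))
|}.

Definition ev : trimap formal T :=
  {| tm_ob := fun a : ob formal => a : ob T; tm_hom := ev_hom |}.

End Formal.

(* Main.v *)
(* A cell of the formal tricategory is a cell of [T] between the evaluated
   boundaries, so each of its axioms is definitionally an axiom of [T] at the
   evaluated cells, and [ev] strictly preserves all structure.  On hom
   bicategories [ev] is an isomorphism on 2-cells and has basic cells as
   preimages; on objects it is the identity, and the unit 1-morphisms are
   biequivalences because l is an adjoint equivalence. *)

Require Import Defs.

Set Implicit Arguments.
Unset Strict Implicit.
Unset Printing Implicit Defensive.
Local Open Scope cell_scope.

Lemma isomorphic1_refl (B : bicat_data) (HB : is_bicat B) (x y : B)
  (u : hom1 x y) : isomorphic1 u u.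
Proof.
exists (id2 u), (id2 u); split; apply (vcomp_id2l HB).
Qed.

Lemma invertible2_sym (B : bicat_data) (x y : B) (u v : hom1 x y)
  (s : hom2 u v) : invertible2 s -> exists t : hom2 v u, invertible2 t.
Proof.
intros [t [H H']]; exists t, s; split; assumption.
Qed.

Lemma equivalent0_refl (B : bicat_data) (HB : is_bicat B) (x : B) :
  equivalent0 x x.
Proof.
exists (id1 x), (id1 x); split; exists (lun (id1 x)), (lunV (id1 x));
  apply (lun_inv HB).
Qed.

(** The components of [fwd] and [bwd] at [x] are quasi-inverse. The counit already points towards
    the identity, whereas the unit starts there and has to be inverted. *)
Lemma adj_equiv_equivalent0 (B C : bicat_data) (F G : functor_data B C)
  (A : adj_data F G) (HA : is_adj_equiv (F := F) (G := G) A) (x : B) :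
  equivalent0 (F x) (G x).
Proof.
exists (fwd A x), (bwd A x); split.
- apply (invertible2_sym (proj2 (unt_mod HA) x)).
- exists (cou A x); apply (proj2 (cou_mod HA) x).
Qed.

(** The component of [l] at the unit itself makes the unit its own quasi-inverse, so one equivalence
    serves both sides. *)
Lemma unit1_biequivalence (T : tricat_data) (HT : is_tricat T) (a : ob T) :
  is_biequivalence1 (unit1 a).
Proof.
exists (unit1 a); split; apply (adj_equiv_equivalent0 (leq_equiv HT a a)).
Qed.

Lemma fhom_bicat (T : tricat_data) (HT : is_tricat T) (a b : ob T) :
  is_bicat (fhom a b).
Proof.
pose proof (hom_bicat HT a b) as HB.
constructor; cbn; intros.
- apply (vcomp_id2l HB).
- apply (vcomp_id2r HB).
- apply (vcomp_assoc HB).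
- apply (hcomp_id2 HB).
- apply (hcomp_vcomp HB).
- apply (assoc_nat HB).
- apply (lun_nat HB).
- apply (run_nat HB).
- apply (assoc_inv HB).
- apply (lun_inv HB).
- apply (run_inv HB).
- apply (pentagon HB).
- apply (triangle HB).
Qed.

Lemma funi_functor (T : tricat_data) (HT : is_tricat T) (a : ob T) :
  is_functor (funi a).
Proof.
pose proof (uni_functor HT a) as HF.
(* There is no eta rule for [unit]: only after the cells of [one_bicat] become literally [tt] do the
   goals match the axioms of [uni a], which [funi] takes at [tt]. *)
constructor; cbn; intros;
  repeat match goal with x : Datatypes.unit |- _ => destruct x end.
- exact (functor_id2 HF (x := tt) (y := tt) tt).
- exact (functor_vcomp HF (x := tt) (y := tt) (u := tt) (v := tt) (w := tt)
    tt tt).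
- exact (phi_nat HF (x := tt) (y := tt) (z := tt) (v := tt) (v' := tt)
    (u := tt) (u' := tt) tt tt).
- exact (phi_inv HF (x := tt) (y := tt) (z := tt) tt tt).
- exact (phi0_inv HF tt).
- exact (phi_assoc HF (w := tt) (x := tt) (y := tt) (z := tt) tt tt tt).
- exact (phi_lun HF (x := tt) (y := tt) tt).
- exact (phi_run HF (x := tt) (y := tt) tt).
Qed.

(** Evaluation of pairs, triples and quadruples of formal cells: the axioms of [T] are pulled back
    along these maps. *)
Definition ev_prod2 (T : tricat_data) (a b c : ob T) :=
  prod_map1 (ev_hom b c) (ev_hom a b).
Definition ev_prod3 (T : tricat_data) (a b c d : ob T) :=
  prod_map1 (ev_prod2 b c d) (ev_hom a b).
Definition ev_prod4 (T : tricat_data) (a b c d e : ob T) :=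
  prod_map1 (ev_prod3 b c d e) (ev_hom a b).

(** A mere change of type: a formal 3-morphism is by definition a 3-morphism between the evaluated
    boundaries. *)
Definition evaluate2 (T : tricat_data) (a b c : ob T)
  (x y : fhom b c × fhom a b) (u v : hom1 x y) (s : hom2 u v) :
  hom2 (m1 (ev_prod2 a b c) u) (m1 (ev_prod2 a b c) v) := ⟨p1 s, p2 s⟩.

Lemma ften_functor (T : tricat_data) (HT : is_tricat T) (a b c : ob T) :
  is_functor (ften a b c).
Proof.
pose proof (ten_functor HT a b c) as HF.
pose (P := ev_prod2 a b c).
constructor; intros.
- exact (functor_id2 HF (m1 P u)).
- exact (functor_vcomp HF (evaluate2 t) (evaluate2 s)).
- exact (phi_nat HF (evaluate2 t) (evaluate2 s)).
- exact (phi_inv HF (m1 P v) (m1 P u)).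
- exact (phi0_inv HF (P x)).
- exact (phi_assoc HF (m1 P h) (m1 P g) (m1 P f)).
- exact (phi_lun HF (m1 P u)).
- exact (phi_run HF (m1 P u)).
Qed.

Definition evaluate3 (T : tricat_data) (a b c d : ob T)
  (x y : fhom c d × fhom b c × fhom a b) (u v : hom1 x y) (s : hom2 u v) :
  hom2 (m1 (ev_prod3 a b c d) u) (m1 (ev_prod3 a b c d) v) :=
  ⟨⟨p1 (p1 s), p2 (p1 s)⟩, p2 s⟩.

(** The axioms of a lifted transformation are those of [Hσ] at cells evaluated by [P]. Only
    [nat_nat] takes a 2-cell of the source bicategory, hence the extra argument [evaluate]. *)
Ltac lift_trans_axioms Hσ P evaluate :=
  constructor;
  [ intros x y u; exact (nat_inv Hσ (m1 P u))
  | intros x y u v s; exact (nat_nat Hσ (evaluate _ _ _ _ s))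
  | intros x y z v u; exact (nat_comp Hσ (m1 P v) (m1 P u))
  | intros x; exact (nat_id1 Hσ (P x)) ].

Ltac lift_mod_axioms HΓ P :=
  split;
  [ intros x y u; exact (proj1 HΓ _ _ (m1 P u))
  | intros x; exact (proj2 HΓ (P x)) ].

Ltac lift_adj_equiv HA P evaluate :=
  constructor;
  [ lift_trans_axioms (fwd_trans HA) P evaluate
  | lift_trans_axioms (bwd_trans HA) P evaluate
  | lift_mod_axioms (unt_mod HA) P
  | lift_mod_axioms (cou_mod HA) P
  | intros x; exact (fwd_triangle HA (P x))
  | intros x; exact (bwd_triangle HA (P x)) ].

Lemma faeq_equiv (T : tricat_data) (HT : is_tricat T) (a b c d : ob T) :
  is_adj_equiv (F := tens_l (@ften T) a b c d) (G := tens_r (@ften T) a b c d)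
    (faeq a b c d).
Proof.
pose proof (aeq_equiv HT a b c d) as HA.
pose (P := ev_prod3 a b c d).
lift_adj_equiv HA P (@evaluate3 T a b c d).
Qed.

Lemma fleq_equiv (T : tricat_data) (HT : is_tricat T) (a b : ob T) :
  is_adj_equiv (F := tens_unit_l (@funi T) (@ften T) a b)
    (G := id_functor (fhom a b)) (fleq a b).
Proof.
pose proof (leq_equiv HT a b) as HA.
pose (P := ev_hom a b).
lift_adj_equiv HA P (@m2 _ _ P).
Qed.

Lemma freq_equiv (T : tricat_data) (HT : is_tricat T) (a b : ob T) :
  is_adj_equiv (F := tens_unit_r (@funi T) (@ften T) a b)
    (G := id_functor (fhom a b)) (freq a b).
Proof.
pose proof (req_equiv HT a b) as HA.
pose (P := ev_hom a b).
lift_adj_equiv HA P (@m2 _ _ P).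
Qed.

Lemma formal_tricat (T : tricat_data) (HT : is_tricat T) :
  is_tricat (formal T).
Proof.
constructor.
- exact (fhom_bicat HT).
- exact (funi_functor HT).
- exact (ften_functor HT).
- exact (faeq_equiv HT).
- exact (fleq_equiv HT).
- exact (freq_equiv HT).
- intros a b c d e.
  lift_mod_axioms (pi_mod HT a b c d e) (@ev_prod4 T a b c d e).
- intros a b c.
  lift_mod_axioms (mu_mod HT a b c) (@ev_prod2 T a b c).
- intros a b c.
  lift_mod_axioms (lambda_mod HT a b c) (@ev_prod2 T a b c).
- intros a b c.
  lift_mod_axioms (rho_mod HT a b c) (@ev_prod2 T a b c).
- intros a b c d e p k j h g f.
  (* Formal identities and associators are basic cells that evaluate to those of [T], so both formal
     pastings unfold to the pastings in [T]. *)
  exact (cocycle HT (ev1 k) (ev1 j) (ev1 h) (ev1 g) (ev1 f)).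
- intros a b c d h g f.
  exact (left_norm HT (ev1 h) (ev1 g) (ev1 f)).
- intros a b c d h g f.
  exact (right_norm HT (ev1 h) (ev1 g) (ev1 f)).
Qed.

Lemma ev_hom_strict (T : tricat_data) (a b : ob T) : is_strict (ev_hom a b).
Proof. constructor; reflexivity. Qed.

Lemma ev_virtually_strict (T : tricat_data) : is_virtually_strict (ev T).
Proof.
(* The boundaries on the two sides are convertible, so [eq1_refl] and [eq2_refl] apply
   throughout. *)
constructor; repeat constructor.
Qed.

Lemma ev_hom_biequivalence (T : tricat_data) (HT : is_tricat T) (a b : ob T) :
  is_biequivalence (ev_hom a b).
Proof.
pose proof (hom_bicat HT a b) as HB.
constructor.
- intros f; exists (basic1 f); exact (equivalent0_refl HB f).
- intros f g α; exists (basic2 α); exact (isomorphic1_refl HB α).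
- intros f g α β Π; exists Π; split; [reflexivity | intros Λ E; exact (eq_sym E)].
Qed.

Theorem proposition3p8p1 (T : tricat_data) (HT : is_tricat T) :
  is_tricat (formal T) /\ is_vs_triequivalence (ev T).
Proof.
split; [exact (formal_tricat HT)|].
constructor.
- exact (ev_virtually_strict T).
- intros a; exists a, (unit1 a); exact (unit1_biequivalence HT a).
- exact (@ev_hom_strict T).
- exact (ev_hom_biequivalence HT).
Qed.
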